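(* The set $A=\bigcup_{n=1}^{\infty}A_n$ is a subring of $\mathbb{R}$.
   Context: $\mathbb{N}$ denotes the positive integers and $\mathbb{N}_0$ the non-negative integers. For integers $a,b$ let $[a,b]_{\mathbb{Z}}=\{k\in\mathbb{Z}:a\le k\le b\}$. Let $S=\{0\}\cup\{2^n:n\in\mathbb{N}_0\}$, and for $n\in\mathbb{N}$ let $nS=\{s_1+\cdots+s_n: s_1,\ldots,s_n\in S\}$ be the $n$-th sumset. For $n\in\mathbb{N}$ define $$A_n=\left\{\sum_{k\in nS}\frac{x_k}{2^k}:\ \text{there exists } t\in\mathbb{N}\text{ such that } x_k\in[-t,t]_{\mathbb{Z}}\text{ for every } k\in nS\right\}\subseteq\mathbb{R}.$$ Subrings are understood to contain $1$. *)

(* Defs.v *)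
From mathcomp Require Import all_boot all_order all_algebra.
From mathcomp Require Import all_classical all_reals all_analysis.
Set Implicit Arguments.
Unset Strict Implicit.
Unset Printing Implicit Defensive.
Import Order.TTheory GRing.Theory Num.Theory.
Import numFieldNormedType.Exports.
Local Open Scope classical_set_scope.
Local Open Scope ring_scope.

Definition S2 : set nat := [set 0%N] `|` [set (2 ^ m)%N | m in [set: nat]].

Definition sumset (X : set nat) (n : nat) : set nat :=
  [set (\sum_(i < n) s i)%N | s in [set s : 'I_n -> nat | forall i, X (s i)]].

(* The digits are given by a total function [x], but only its values on
   [sumset S2 n] are constrained or used. As the digits are bounded, the series
   converges absolutely, so summing in increasing order of [k] is harmless. *)
Definition An (R : realType) (n : nat) : set R :=
  [set r | exists x : nat -> int,
    (exists2 t : nat, (0 < t)%N &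
       forall k, sumset S2 n k -> - t%:Z <= x k <= t%:Z) /\
    \sum_(0 <= k < N | k \in sumset S2 n) (x k)%:~R / 2 ^+ k
      @[N --> \oo] --> r].

Arguments An : clear implicits.

Definition Aunion (R : realType) : set R :=
  \bigcup_(n in [set n | (0 < n)%N]) An R n.

Arguments Aunion : clear implicits.

(* Main.v *)
(* Since [0] is in [S], the sets [A_n] increase with [n], and each is closed under
   subtraction.  For a product of elements of [A_m] and [A_n], the Cauchy product
   of the two series has as [j]-th digit the sum of [x_k * y_l] over the pairs
   [k] in [mS], [l] in [nS] with [k + l = j].  It is supported on [(m + n)S], and
   it is bounded because the number of such pairs is bounded independently of
   [j]: some term of [k] or [l] is a power of two comparable to [j], which leaves
   boundedly many choices for it, and one inducts on [m + n]. *)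
Require Import Defs.
From mathcomp Require Import all_boot all_order all_algebra.
From mathcomp Require Import all_classical all_reals all_analysis.
From mathcomp Require Import zify ring.
Set Implicit Arguments.
Unset Strict Implicit.
Unset Printing Implicit Defensive.
Import Order.TTheory GRing.Theory Num.Theory.
Import numFieldNormedType.Exports.
Local Open Scope classical_set_scope.
Local Open Scope ring_scope.

Lemma sumset0P (X : set nat) k : sumset X 0 k <-> k = 0%N.
Proof.
split=> [[s _ <-]|->]; first by rewrite big_ord0.
by exists (fun=> 0%N) => [[]|] //; rewrite big_ord0.
Qed.

Lemma sumsetD (X : set nat) m n k l :
  sumset X m k -> sumset X n l -> sumset X (m + n) (k + l)%N.
Proof.
move=> [s Xs <-] [s' Xs' <-].
exists (fun i : 'I_(m + n) => match fintype.split i with inl i1 => s i1 | inr i2 => s' i2 end).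
  by move=> i /=; case: (fintype.split i).
rewrite big_split_ord; congr addn; apply: eq_bigr => i _.
  by case: splitP => [j /= /val_inj->|j /=] //; have := ltn_ord i; lia.
case: splitP => [j /=|j /= /addnI/val_inj->] //; have := ltn_ord j; lia.
Qed.

(** The largest of the [n.+1] terms is at least their average; [k'] is the sum of the others. *)
Lemma sumset_pick_large (X : set nat) n k : sumset X n.+1 k ->
  exists p k', [/\ X p, sumset X n k', k = (p + k')%N & (k <= n.+1 * p)%N].
Proof.
move=> [s Xs <-]; have [i _ imax] := @arg_maxnP _ ord0 predT s isT.
exists (s i), (\sum_(j < n) s (lift i j))%N; split=> //.
- by exists (fun j => s (lift i j)) => // j; apply: Xs.
- by rewrite (bigD1_ord i).
- by rewrite -[X in (X * _)%N]card_ord -sum_nat_const leq_sum // => j _; apply: imax.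
Qed.

(** A nonzero [p] is [2 ^ m] with [j / M <= 2 ^ m <= j], so [m] is at most [trunc_log 2 j] and less
    than [M] below it. The list has [M.+1] entries whatever [j] is. *)
Lemma S2_between M j p :
  S2 p -> (p <= j)%N -> (j <= M * p)%N ->
  p \in 0%N :: [seq (2 ^ (trunc_log 2 j - i))%N | i <- iota 0 M].
Proof.
move=> [->|[m _ <-]] pj jM; first by rewrite mem_head.
rewrite inE; apply/orP; right; apply/mapP.
have j0 : (0 < j)%N by apply: leq_trans pj; rewrite expn_gt0.
have /andP[jl ju] := trunc_log_bounds (ltnSn 1) j0.
have mt : (m <= trunc_log 2 j)%N by apply: trunc_log_max.
exists (trunc_log 2 j - m)%N; last by rewrite subKn.
(* By [i < 2 ^ i] it is enough that [2 ^ (trunc_log 2 j - m) <= M]. *)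
rewrite mem_iota add0n /=; apply: leq_trans (ltn_expl _ (ltnSn 1)) _.
rewrite -(leq_pmul2r (expn_gt0 2 m)) -expnD subnK //.
exact: leq_trans jl jM.
Qed.

(* One of the two summands is at least [j / 2], hence contains a term of [S]
   that is at least [j / (2 (m + n))]; removing it leaves a pair of the same
   kind with one term fewer. *)
Lemma sumset_pairs_bounded m n : exists C, forall j, exists L : seq nat,
  (size L <= C)%N /\ forall k l, sumset S2 m k -> sumset S2 n l ->
    (k + l)%N = j -> k \in L.
Proof.
elim: m n => [|m IHm] n.
  exists 1%N => j; exists [:: 0%N]; split=> // k l /sumset0P -> _ _.
  by rewrite mem_head.
elim: n => [|n [C2 H2]].
  exists 1%N => j; exists [:: j]; split=> // k l _ /sumset0P -> <-.
  by rewrite addn0 mem_head.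
have [C1 H1] := IHm n.+1.
(* The factor [2] is for the larger summand being at least [j / 2]; the other factor exceeds the
   number of terms of either summand. *)
pose M := (2 * (m.+1 + n.+1))%N.
exists (M.+1 * (C1 + C2))%N => j.
have [/choice[L1 H1'] /choice[L2 H2']] := (H1, H2).
pose P := 0%N :: [seq (2 ^ (trunc_log 2 j - i))%N | i <- iota 0 M].
(* Candidates for [k] once [p] is removed: from [k] itself in the first list, from [l] in the
   second. *)
pose Q p := [seq (p + k)%N | k <- L1 (j - p)%N] ++ L2 (j - p)%N.
exists (flatten (map Q P)); split.
  have -> : M.+1 = size P by rewrite /= size_map size_iota.
  elim: P => //= p P IH; rewrite size_cat mulSn leq_add // size_cat size_map.
  by apply: leq_add; [case: (H1' (j - p)%N) | case: (H2' (j - p)%N)].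
move=> k l Sk Sl jE; apply/flatten_mapP.
have [lk|kl] := leqP l k.
  have [p [k' [Sp Sk' kE kp]]] := sumset_pick_large Sk.
  exists p; first by apply: S2_between Sp _ _; rewrite /M; nia.
  rewrite mem_cat; apply/orP; left; apply/mapP; exists k' => //.
  by apply: (H1' (j - p)%N).2 Sk' Sl _; lia.
have [p [l' [Sp Sl' lE lp]]] := sumset_pick_large Sl.
exists p; first by apply: S2_between Sp _ _; rewrite /M; nia.
rewrite mem_cat; apply/orP; right.
by apply: (H2' (j - p)%N).2 Sk Sl' _; lia.
Qed.

(** Both sides add up [a k * b l] over the triangle [k + l < N]. *)
Lemma cauchy_partial_sum (K : pzSemiRingType) (a b : nat -> K) N :
  \sum_(0 <= j < N) \sum_(0 <= k < j.+1) a k * b (j - k)%N =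
  \sum_(0 <= k < N) a k * \sum_(0 <= l < N - k) b l.
Proof.
elim: N => [|N IH]; first by rewrite !big_nil.
rewrite big_nat_recr //= IH [RHS]big_nat_recr //= subSnn big_nat1.
rewrite [X in _ + X = _]big_nat_recr //= subnn addrA -big_split /=.
congr (_ + _); apply: eq_big_nat => k /andP[_ kN].
by rewrite subSn ?(ltnW kN) // big_nat_recr //= mulrDr.
Qed.

(** Gives [N ^ 2 / 2 ^ N <= 8 / N], so that the error of the Cauchy product tends to [0]. *)
Lemma cube_le_exp2 n : (n ^ 3 <= 8 * 2 ^ n)%N.
Proof.
elim: n => // n IH; case: (leqP n 4) => n4.
  by case: n n4 {IH} => [|[|[|[|[|]]]]].
(* For [n > 4], passing from [n] to [n.+1] at most doubles the cube. *)
apply: (leq_trans (n := (2 * n ^ 3)%N)); last by rewrite (expnS 2); lia.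
have h1 : (4 * n <= n * n)%N by rewrite leq_mul2r (ltnW n4) orbT.
have h2 : (4 * (n * n) <= n * (n * n))%N by rewrite leq_mul2r (ltnW n4) orbT.
by rewrite !expnS !expn0; lia.
Qed.

(* The product of the [N]-th partial sums differs from that of the Cauchy product
   by at most [N ^ 2] terms, each at most [c d / 2 ^ N]. *)
Lemma cvg_cauchy_product (R : realType) (a b : R^nat) (c d r s : R) :
  (forall k, `|a k| <= c / 2 ^+ k) -> (forall k, `|b k| <= d / 2 ^+ k) ->
  series a @ \oo --> r -> series b @ \oo --> s ->
  series (fun j => \sum_(0 <= k < j.+1) a k * b (j - k)%N) @ \oo --> r * s.
Proof.
move=> ac bd ar bs.
have c0 : 0 <= c by have := ac 0%N; rewrite expr0 divr1; apply: le_trans.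
have d0 : 0 <= d by have := bd 0%N; rewrite expr0 divr1; apply: le_trans.
set e : R^nat := series _.
(* What remains of the square [k, l < N] is the part with [k + l >= N]. *)
have eE N : series a N * series b N - e N =
    \sum_(0 <= k < N) \sum_(N - k <= l < N) a k * b l.
  rewrite /e /series /= cauchy_partial_sum mulr_suml -sumrB.
  apply: eq_big_nat => k /andP[_ kN].
  rewrite -mulrBr -mulr_sumr (big_cat_nat (n := (N - k)%N)) ?leq_subr //=.
  by rewrite addrAC subrr add0r.
have bound N : `|series a N * series b N - e N| <= 8 * c * d / N%:R.
  (* At [N = 0] both sides are [0], since the inverse of [0] is [0]. *)
  have [->|N0] := posnP N.
    by rewrite eE big_nil normr0 invr0 mulr0.
  have termE k l : (0 <= k < N)%N -> (N - k <= l < N)%N ->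
      `|a k * b l| <= c * d / 2 ^+ N.
    move=> /andP[_ kN] /andP[kl lN]; rewrite normrM.
    apply: (le_trans (ler_pM _ _ (ac k) (bd l))) => //.
    rewrite mulrACA -invfM -exprD ler_wpM2l ?mulr_ge0 // lef_pV2 ?posrE ?exprn_gt0 //.
    by rewrite ler_weXn2l ?ler1n //; lia.
  have step : `|series a N * series b N - e N| <= N%:R * (N%:R * (c * d / 2 ^+ N)).
    rewrite eE; apply: le_trans (ler_norm_sum _ _ _) _.
    rewrite mulr_natl -[N in _ *+ N]subn0 -sumr_const_nat.
    apply: ler_sum_nat => k kN; apply: le_trans (ler_norm_sum _ _ _) _.
    apply: le_trans (ler_sum_nat (termE k ^~ kN)) _.
    rewrite sumr_const_nat mulr_natl ler_wpMn2l ?leq_subr //.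
    by rewrite divr_ge0 ?mulr_ge0 ?exprn_ge0.
  apply: le_trans step _.
  have N0' : (0 : R) < N%:R by rewrite ltr0n.
  rewrite !mulrA ler_pdivrMr ?exprn_gt0 // [leRHS]mulrAC ler_pdivlMr //.
  have /(ler_wpM2l (mulr_ge0 c0 d0)) : (N%:R ^+ 3 <= 8 * 2 ^+ N :> R).
    by rewrite -!natrX -natrM ler_nat cube_le_exp2.
  by congr (_ <= _); ring.
have -> : e = (series a \* series b) - (series a \* series b - e).
  by apply/funext => N; rewrite /= opprB addrC subrK.
rewrite -[r * s]subr0; apply: cvgB; first exact: cvgM.
apply/norm_cvg0P/(squeeze_cvgr (f := fun=> 0) (h := fun N => 8 * c * d / N%:R)).
- by apply: nearW => N; rewrite normr_ge0 bound.
- exact: cvg_cst.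
rewrite -(mulr0 (8 * c * d)); apply: cvgMr.
(* [harmonic] is [1 / (N + 1)], hence the shift. *)
rewrite -cvg_shiftS.
exact: cvg_harmonic.
Qed.

(** Setting the digits to [0] outside the sumset turns the restricted sum into a plain [series], to
    which the limit laws apply. *)
Lemma AnP (R : realType) n r : An R n r <-> exists x : nat -> int, exists t : nat,
  [/\ forall k, `|x k| <= t%:Z, forall k, ~ sumset S2 n k -> x k = 0 &
      series (fun k => (x k)%:~R / 2 ^+ k : R) @ \oo --> r].
Proof.
split=> [[x [[t t0 xt] xr]]|[x [t [xt x0 xr]]]].
  exists (fun k => if k \in sumset S2 n then x k else 0), t; split=> [k|k|].
  - case: ifPn => [|_]; last by rewrite normr0.
    by rewrite in_setE ler_norml => /xt.
  - by move=> nk; case: ifPn => //; rewrite in_setE.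
  rewrite (_ : series _ = fun N : nat => \sum_(0 <= k < N | k \in sumset S2 n)
    (x k)%:~R / 2 ^+ k) //; apply/funext => N.
  rewrite [RHS]big_mkcond; apply: eq_bigr => k _.
  by case: ifP => // _; rewrite mul0r.
exists x; split.
  by exists t.+1 => // k _; have := xt k; lia.
rewrite (_ : (fun N => _) = series (fun k => (x k)%:~R / 2 ^+ k : R)) //.
apply/funext => N; rewrite big_mkcond; apply: eq_bigr => k _.
by case: ifPn => //; rewrite notin_setE => /x0->; rewrite mul0r.
Qed.

Lemma An_le (R : realType) m n : (m <= n)%N -> An R m `<=` An R n.
Proof.
move=> mn r /AnP[x [t [xt x0 xr]]]; apply/AnP; exists x, t; split=> // k nk.
apply: x0 => mk; apply: nk; rewrite -(subnKC mn) -[k]addn0.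
apply: sumsetD => //; exists (fun=> 0%N); last by rewrite big1.
by move=> i; left.
Qed.

(** The empty sum makes [sumset S2 0] equal to [{0}], so a single digit [1] at [0] is available. *)
Lemma An1 (R : realType) : An R 0 1.
Proof.
apply/AnP; exists (fun k => (k == 0%N)%:Z), 1%N; split=> [k|k nk|].
- by case: eqP.
- by case: eqP nk => // -> []; apply/sumset0P.
rewrite -cvg_shiftS (_ : mk_sequence _ = cst 1); first exact: cvg_cst.
apply/funext => N; rewrite /series /= big_nat_recl //= big1_seq ?addr0 ?divr1 //.
by move=> i _; rewrite mul0r.
Qed.

Lemma AnB (R : realType) n r s : An R n r -> An R n s -> An R n (r - s).
Proof.
move=> /AnP[x [t [xt x0 xr]]] /AnP[y [u [yu y0 ys]]].
apply/AnP; exists (fun k => x k - y k), (t + u)%N; split=> [k|k nk|].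
- by have := xt k; have := yu k; lia.
- by rewrite x0 // y0.
rewrite (_ : series _ = series (fun k => (x k)%:~R / 2 ^+ k)
    - series (fun k => (y k)%:~R / 2 ^+ k)); first exact: cvgB.
rewrite -seriesN -seriesD; congr series; apply/funext => k /=.
by rewrite rmorphB mulrBl.
Qed.

Lemma AnM (R : realType) m n r s :
  An R m r -> An R n s -> An R (m + n) (r * s).
Proof.
move=> /AnP[x [t [xt x0 xr]]] /AnP[y [u [yu y0 ys]]].
have [C HC] := sumset_pairs_bounded m n.
have digit_bound (z : nat -> int) v : (forall k, `|z k| <= v%:Z) ->
    forall k, `|(z k)%:~R / 2 ^+ k : R| <= v%:R / 2 ^+ k.
  move=> zv k; rewrite normrM [X in _ * X]ger0_norm ?invr_ge0 ?exprn_ge0 //.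
  by rewrite ler_wpM2r ?invr_ge0 ?exprn_ge0 // -intr_norm; move: (zv k); rewrite -(ler_int R).
apply/AnP; exists (fun j => \sum_(0 <= k < j.+1) x k * y (j - k)%N), (C * (t * u))%N.
split=> [j|j nj|].
- have [L [sL HL]] := HC j.
  apply: le_trans (ler_norm_sum _ _ _) _.
  (* Outside [L] one of the two digits vanishes; at most [C] terms are left, each at most
     [t * u]. *)
  rewrite (bigID (mem L)) /= [X in _ + X]big1_seq ?addr0; last first.
    move=> k /andP[kL]; rewrite mem_index_iota => /andP[_ kj].
    have [Sk|/x0->] := pselect (sumset S2 m k); last by rewrite mul0r normr0.
    have [Sl|/y0->] := pselect (sumset S2 n (j - k)%N); last by rewrite mulr0 normr0.
    by move/negP: kL; case; apply: HL Sk Sl _; rewrite subnKC.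
  have tu k : `|x k * y (j - k)%N| <= (t * u)%:Z.
    by rewrite normrM PoszM ler_pM.
  apply: le_trans (ler_sum _ (fun k _ => tu k)) _.
  rewrite big_const_seq iter_addr_0 -mulr_natr natz -PoszM lez_nat mulnC.
  rewrite leq_mul2r; apply/orP; right; apply: leq_trans sL.
  (* The indices are distinct, so those in [L] number at most [size L]. *)
  rewrite -size_filter; apply: uniq_leq_size.
    by rewrite filter_uniq ?iota_uniq.
  by move=> k; rewrite mem_filter => /andP[].
- rewrite big1_seq // => k /andP[_]; rewrite mem_index_iota => /andP[_ kj].
  have [Sk|/x0->] := pselect (sumset S2 m k); last by rewrite mul0r.
  have [Sl|/y0->] := pselect (sumset S2 n (j - k)%N); last by rewrite mulr0.
  by case: nj; rewrite -(@subnKC k j) //; apply: sumsetD.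
rewrite (_ : series _ = series (fun j => \sum_(0 <= k < j.+1)
    (x k)%:~R / 2 ^+ k * ((y (j - k)%N)%:~R / 2 ^+ (j - k)))).
  exact: cvg_cauchy_product (digit_bound _ _ xt) (digit_bound _ _ yu) xr ys.
congr series; apply/funext => j.
rewrite rmorph_sum /= mulr_suml; apply: eq_big_nat => k /andP[_ kj].
by rewrite mulrACA -invfM -exprD subnKC // rmorphM.
Qed.

Theorem theorem3 (R : realType) : GRing.subring_closed [in Aunion R].
Proof.
split=> [|r s|r s].
(* The union starts at [1], so [1] is moved up from [An R 0]. *)
- by rewrite in_setE; exists 1%N => //; apply: An_le (An1 R).
- rewrite !in_setE => -[m m0 Ar] [n n0 As]; exists (m + n)%N.
    by rewrite /= addn_gt0 m0.
  by apply: AnB; [apply: An_le Ar; apply: leq_addr|apply: An_le As; apply: leq_addl].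
- rewrite !in_setE => -[m m0 Ar] [n n0 As]; exists (m + n)%N; last exact: AnM.
  by rewrite /= addn_gt0 m0.
Qed.
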